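(* Let $q$ be a prime power, $\mathbb{F}_q$ the field with $q$ elements, and $E \subset \mathbb{F}_q^2$. Then the following hold. (i) Suppose that $|E|>q$. Then $|V_2(E)| \geq \frac{q-1}{2}$. Moreover, the triangles giving at least $\frac{q-1}{2}$ distinct areas can be chosen to share the same base: there exist distinct points $e_1,e_2\in E$ and points $x_1,\dots,x_m\in E$ with $m\geq \frac{q-1}{2}$ such that the values $\det(e_1-x_i,\,e_2-x_i)$, $i=1,\dots,m$, are nonzero and pairwise distinct. (ii) There is an absolute constant $C$ such that if $q\geq C$ and $|E| \ge 64q \log_2 q$, then there exists $z \in E$ such that $|V^z_2(E)| > \frac{q}{2}$.
   Context: For $E\subseteq\mathbb{F}_q^2$, $V_2(E)=\{\det(x^1-x^3,\,x^2-x^3): x^1,x^2,x^3\in E\}\setminus\{0\}$ is the set of nonzero (signed, determinant-normalized) triangle areas determined by $E$, and for fixed $z\in E$, $V_2^z(E)=\{\det(x^1-z,\,x^2-z): x^1,x^2\in E\}\setminus\{0\}$ is the set of pinned nonzero areas at vertex $z$. Here $\det(u,v)$ denotes the determinant of the $2\times 2$ matrix with columns $u,v$. *)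

(* Defs.v *)
From HB Require Import structures.
From mathcomp Require Import all_boot all_order all_algebra.
From mathcomp Require Import reals exp.

Set Implicit Arguments.
Unset Strict Implicit.
Unset Printing Implicit Defensive.

Import GRing.Theory.
Local Open Scope ring_scope.

Section Areas.
Variable F : finFieldType.
Implicit Types (u v z : 'cV[F]_2) (E : {set 'cV[F]_2}).

Definition det2 u v : F := \det (row_mx u v : 'M[F]_2).

Definition V2 E : {set F} :=
  [set a | [exists x1 in E, exists x2 in E, exists x3 in E,
              a == det2 (x1 - x3) (x2 - x3)]] :\ 0.

Definition V2_pinned z E : {set F} :=
  [set det2 (x1 - z) (x2 - z) | x1 in E, x2 in E] :\ 0.

End Areas.

Definition log2 (R : realType) (x : R) : R := ln x / ln 2.

(* Main.v *)
(** The area det (e1 - x, e2 - x) depends only on the line parallel to e1 - e2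
    through x, so both parts follow from one direction d for which E meets many
    lines parallel to d.  Two distinct points of E are aligned along exactly one
    of the q + 1 directions, so some d has at most n + n (n - 1) / (q + 1)
    ordered pairs (x, y) of E with x - y parallel to d, where n = |E|; by
    Cauchy-Schwarz, E then meets at least n (q + 1) / (q + n) lines parallel
    to d.  As n > q, two points of E lie on one of them, and these two points
    are the common base.  Either of them also serves as the pinned vertex in
    (ii), where n >= 2 q gives at least 2 (q + 1) / 3 lines. *)
Require Import Defs.
From HB Require Import structures.
From mathcomp Require Import all_boot all_order all_algebra.
From mathcomp Require Import reals exp.
From mathcomp Require Import ring lra zify.

Set Implicit Arguments.
Unset Strict Implicit.
Unset Printing Implicit Defensive.

Import Order.TTheory GRing.Theory Num.Theory.
Local Open Scope ring_scope.

(** After doubling both sides, this is [2 a_i a_j <= a_i^2 + a_j^2] summed over all ordered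
    pairs. *)
Lemma sum_sqr_le_card (T : finType) (A : {set T}) (a : T -> nat) :
  ((\sum_(i in A) a i) ^ 2 <= #|A| * \sum_(i in A) a i ^ 2)%N.
Proof.
rewrite -(leq_pmul2l (isT : 0 < 2)%N).
have -> : (2 * (#|A| * \sum_(i in A) a i ^ 2) =
  \sum_(i in A) \sum_(j in A) (a i ^ 2 + a j ^ 2))%N.
  under [RHS]eq_bigr do rewrite big_split /= sum_nat_const.
  by rewrite big_split /= sum_nat_const -big_distrr /= mul2n addnn.
rewrite -mulnn big_distrlr /= big_distrr leq_sum // => i _.
rewrite big_distrr leq_sum // => j _.
exact: nat_Cauchy.
Qed.

(** Cauchy-Schwarz on the fibre sizes of [f]: they sum to [#|A|], and their squares count the
    ordered pairs that [f] identifies. *)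
Lemma card_sqr_le_imset (T U : finType) (f : T -> U) (A : {set T}) :
  (#|A| ^ 2 <= #|f @: A| * \sum_(x in A) \sum_(y in A) (f x == f y))%N.
Proof.
have fibre (u : U) : (\sum_(x in A | f x == u) 1 = \sum_(x in A) (f x == u))%N.
  by rewrite big_mkcondr.
have -> : #|A| = (\sum_(u in f @: A) \sum_(x in A) (f x == u))%N.
  rewrite -sum1_card (partition_big_imset f) /=.
  by apply: eq_bigr => u _; rewrite fibre.
have -> : (\sum_(x in A) \sum_(y in A) (f x == f y) =
  \sum_(u in f @: A) (\sum_(x in A) (f x == u)) ^ 2)%N.
  rewrite (partition_big_imset f) /=; apply: eq_bigr => u _.
  rewrite -mulnn -{1}fibre big_distrl /=; apply: eq_bigr => x /andP[_ /eqP ->].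
  by rewrite mul1n; apply: eq_bigr => y _; rewrite eq_sym.
exact: sum_sqr_le_card.
Qed.

Section Det2.
Variable F : finFieldType.
Implicit Types (u v w d : 'cV[F]_2) (E : {set 'cV[F]_2}).

Lemma det2E u v : det2 u v = u 0 0 * v 1 0 - u 1 0 * v 0 0.
Proof.
have l01 : lift 0 0 = 1 :> 'I_2 by apply: val_inj.
have l10 : lift 1 0 = 0 :> 'I_2 by apply: val_inj.
have s0 : split (0 : 'I_(1 + 1)) = inl 0.
  by rewrite -[RHS]unsplitK; congr split; apply: val_inj.
have s1 : split (1 : 'I_(1 + 1)) = inr 0.
  by rewrite -[RHS]unsplitK; congr split; apply: val_inj.
rewrite /det2 (expand_det_row _ 0) big_ord_recl big_ord1 /cofactor !det_mx11.
by rewrite !mxE !l01 l10 !s0 !s1 /=; ring.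
Qed.

Lemma det2Zl c u v : det2 (c *: u) v = c * det2 u v.
Proof. by rewrite !det2E !mxE; ring. Qed.

Lemma det2Br u v w : det2 u (v - w) = det2 u v - det2 u w.
Proof. by rewrite !det2E !mxE; ring. Qed.

(** For a fixed base, the area is an affine function of the apex [w], so counting areas amounts to
    counting values of the linear form [det2 (v - u)]. *)
Lemma det2_base u v w : det2 (u - w) (v - w) = det2 (v - u) w - det2 (v - u) u.
Proof. by rewrite !det2E !mxE; ring. Qed.

Lemma cV2P u v : u 0 0 = v 0 0 -> u 1 0 = v 1 0 -> u = v.
Proof.
move=> h0 h1; apply/colP => i; case: i => [[|[|//]] Hi].
- by have -> : Ordinal Hi = 0 by apply: val_inj.
- by have -> : Ordinal Hi = 1 by apply: val_inj.
Qed.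

Lemma det2_eq0 u v : v != 0 -> det2 u v = 0 -> exists c, u = c *: v.
Proof.
rewrite det2E => v_neq0 /eqP; rewrite subr_eq0 => /eqP uv.
have [v0|v0] := eqVneq (v 0 0) 0; last first.
  by exists (u 0 0 / v 0 0); apply: cV2P; rewrite !mxE ?divfK // mulrAC uv mulfK.
have v1 : v 1 0 != 0.
  by apply: contra_neq v_neq0 => v1; apply: cV2P; rewrite mxE.
by exists (u 1 0 / v 1 0); apply: cV2P; rewrite !mxE ?divfK // mulrAC -uv mulfK.
Qed.

Lemma card_det2_eq0 v : v != 0 ->
  (\sum_(d in [set~ 0%R]) (det2 d v == 0%R) <= #|F|.-1)%N.
Proof.
move=> v_neq0.
rewrite -big_mkcondr sum1_card -(cardC1 (0 : F)) -cardsE.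
apply: leq_trans (leq_imset_card (fun c => c *: v) (predC1 0)).
apply/subset_leq_card/subsetP => d /=.
rewrite inE => /andP[]; rewrite in_setC1 => d_neq0 /eqP dv.
have [c d_cv] := det2_eq0 v_neq0 dv.
apply/imsetP; exists c => //; rewrite inE.
by apply: contra_neq d_neq0 => c0; rewrite d_cv c0 scale0r.
Qed.

(** For [d != 0], [det2 d x] labels the line through [x] parallel to [d]; the diagonal pairs are
    counted too. *)
Definition collisions d E : nat :=
  (\sum_(x in E) \sum_(y in E) (det2 d x == det2 d y))%N.

(** Write q for [#|F|] and n for [#|E|]. A diagonal pair collides for all q^2 - 1 nonzero [d], any
    other pair only for the at most q - 1 nonzero multiples of its difference; and n (q^2 - 1) + n
    (n - 1) (q - 1) = n (q - 1) (q + n). *)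
Lemma sum_collisions_le E :
  (\sum_(d in [set~ 0%R]) collisions d E <=
   #|E| * (#|F|.-1 * (#|F| + #|E|)))%N.
Proof.
have F_gt1 : (1 < #|F|)%N := card_finNzRing_gt1 F.
rewrite /collisions exchange_big -sum_nat_const leq_sum //= => x xE.
rewrite exchange_big (bigD1 x) //=.
under eq_bigr do rewrite eqxx.
rewrite sum_nat_const muln1 cardsC1 card_mx muln1.
have off_diag : (\sum_(y in E | y != x) \sum_(d in [set~ 0%R])
    (det2 d x == det2 d y) <= #|E|.-1 * #|F|.-1)%N.
  rewrite (cardsD1 x E) xE /= -sum_nat_const.
  rewrite [leqRHS](eq_bigl (fun y => (y \in E) && (y != x))); last first.
    by move=> y; rewrite !inE andbC.
  apply: leq_sum => y /andP[_ yx].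
  under eq_bigr do rewrite -subr_eq0 -det2Br.
  by apply: card_det2_eq0; rewrite subr_eq0 eq_sym.
have E_gt0 : (0 < #|E|)%N by apply/card_gt0P; exists x.
apply: leq_trans (leq_add (leqnn _) off_diag) _.
rewrite -(prednK E_gt0) -(prednK (ltnW F_gt1)) /=.
nia.
Qed.

Lemma exists_rich_direction E : (0 < #|E|)%N ->
  exists2 d, d != 0 &
    (#|E| * #|F|.+1 <= #|det2 d @: E| * (#|F| + #|E|))%N.
Proof.
move=> E_gt0; have F_gt1 : (1 < #|F|)%N := card_finNzRing_gt1 F.
(* Averaging over nonzero vectors stands for averaging over directions: each direction has q - 1
   representatives, and this factor cancels from q^2 - 1 = (q + 1) (q - 1). *)
have [d d_neq0 few] : exists2 d, d != 0 &
    (#|F|.+1 * collisions d E <= #|E| * (#|F| + #|E|))%N.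
  apply/exists_inP; apply: contraT; rewrite negb_exists_in => /forall_inP many.
  have : (\sum_(d in [set~ 0%R : 'cV[F]_2]) (#|E| * (#|F| + #|E|)).+1 <=
          #|F|.+1 * (#|E| * (#|F|.-1 * (#|F| + #|E|))))%N.
    apply: leq_trans (leq_mul (leqnn _) (sum_collisions_le E)).
    rewrite big_distrr leq_sum // => d; rewrite !inE => /many.
    by rewrite -ltnNge.
  rewrite sum_nat_const cardsC1 card_mx muln1.
  have -> : ((#|F| ^ 2).-1 = #|F|.+1 * #|F|.-1)%N by rewrite -mulnn; lia.
  rewrite (mulnCA #|E|) mulnA leq_pmul2l ?ltnn // muln_gt0; lia.
exists d => //.
have := card_sqr_le_imset (det2 d) E; rewrite -/(collisions d E) => CS.
(* The extra factor [#|E|] produces the square that [CS] bounds; [few] then bounds the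
   collisions. *)
rewrite -(leq_pmul2l E_gt0).
apply: leq_trans (_ : #|det2 d @: E| * (#|F|.+1 * collisions d E) <= _)%N.
  by rewrite mulnA mulnn mulnCA mulnC leq_mul2l CS orbT.
by rewrite [leqRHS]mulnCA leq_mul.
Qed.

(** Pigeonhole: [det2 d] has at most q values, so it agrees at two points of [E], whose difference
    is then parallel to [d]. Rescaling [d] to that difference loses no values. *)
Lemma exists_rich_base E : (#|F| < #|E|)%N ->
  exists e1 e2, [/\ e1 \in E, e2 \in E, e1 != e2 &
    (#|E| * #|F|.+1 <= #|det2 (e2 - e1) @: E| * (#|F| + #|E|))%N].
Proof.
move=> FE; have [|d d_neq0 rich] := @exists_rich_direction E.
  exact: leq_ltn_trans FE.
have /dinjectivePn[e1 e1E [e2]] : ~~ dinjectiveb (det2 d) (mem E).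
  apply/negP => /dinjectiveP inj.
  by have := max_card (mem (det2 d @: E)); rewrite card_in_imset // leqNgt FE.
rewrite !inE => /andP[e2_neq e2E] d12.
exists e1, e2; split=> //; first by rewrite eq_sym.
have [c d_c] : exists c, d = c *: (e2 - e1).
  by apply: det2_eq0; rewrite ?subr_eq0 // det2Br d12 subrr.
apply: leq_trans rich _; rewrite leq_mul2r; apply/orP; right.
have -> : det2 d @: E = ( *%R c) @: (det2 (e2 - e1) @: E).
  by rewrite -imset_comp; apply: eq_imset => x; rewrite /= d_c det2Zl.
exact: leq_imset_card.
Qed.

Definition base_areas e1 e2 E : {set F} :=
  [set det2 (e1 - x) (e2 - x) | x in E] :\ 0.

(** The two images differ by a translation. The successor accounts for the removed area 0, attained
    at the apex [e1]. *)
Lemma card_base_areas e1 e2 E : e1 \in E ->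
  #|base_areas e1 e2 E|.+1 = #|det2 (e2 - e1) @: E|.
Proof.
move=> e1E.
have -> : #|det2 (e2 - e1) @: E| = #|[set det2 (e1 - x) (e2 - x) | x in E]|.
  rewrite -(card_imset _ (addIr (- det2 (e2 - e1) e1))) -imset_comp.
  by congr #|pred_of_set _|; apply: eq_imset => x /=; rewrite det2_base.
suff area0 : 0 \in [set det2 (e1 - x) (e2 - x) | x in E].
  by rewrite [RHS](cardsD1 0) area0.
by apply/imsetP; exists e1; rewrite // det2_base subrr.
Qed.

Lemma base_areas_sub_V2 e1 e2 E : e1 \in E -> e2 \in E ->
  base_areas e1 e2 E \subset V2 E.
Proof.
move=> e1E e2E; apply/setSD/subsetP => _ /imsetP[x xE ->].
rewrite inE; apply/exists_inP; exists e1 => //.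
by apply/exists_inP; exists e2 => //; apply/exists_inP; exists x.
Qed.

(** Cyclic symmetry of the signed area: det (e1 - x, e2 - x) = det (e2 - e1, x - e1), which moves
    the pin to [e1]. *)
Lemma base_areas_sub_pinned e1 e2 E : e2 \in E ->
  base_areas e1 e2 E \subset V2_pinned e1 E.
Proof.
move=> e2E; apply/setSD/subsetP => _ /imsetP[x xE ->].
by apply/imset2P; exists e2 x; rewrite // det2_base det2Br.
Qed.

Lemma base_areas_index e1 e2 E :
  exists x : 'I_#|base_areas e1 e2 E| -> 'cV[F]_2,
    [/\ forall i, x i \in E,
        forall i, det2 (e1 - x i) (e2 - x i) != 0 &
        injective (fun i => det2 (e1 - x i) (e2 - x i))].
Proof.
have apexP (i : 'I_#|base_areas e1 e2 E|) :
    exists x, (x \in E) && (enum_val i == det2 (e1 - x) (e2 - x)).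
  have := enum_valP i; rewrite inE => /andP[_ /imsetP[x xE ->]].
  by exists x; rewrite xE eqxx.
pose x i := xchoose (apexP i).
have xP i : x i \in E /\ det2 (e1 - x i) (e2 - x i) = enum_val i.
  by have /andP[? /eqP ->] := xchooseP (apexP i).
exists x; split=> [i|i|i j /=]; first by case: (xP i).
  by have := enum_valP i; rewrite (xP i).2 !inE => /andP[].
by rewrite !(xP _).2 => /enum_val_inj.
Qed.

Lemma exists_rich_base_areas E : (#|F| < #|E|)%N ->
  exists e1 e2, [/\ e1 \in E, e2 \in E, e1 != e2 &
    (#|E| * #|F|.+1 <= #|base_areas e1 e2 E|.+1 * (#|F| + #|E|))%N].
Proof.
move=> /exists_rich_base[e1 [e2 [e1E e2E e12 rich]]].
by exists e1, e2; split=> //; rewrite card_base_areas.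
Qed.
End Det2.

Theorem theorem1p1 (R : realType) :
  (forall (F : finFieldType) (E : {set 'cV[F]_2}),
     (#|F| < #|E|)%N ->
     (#|F|%:R - 1) / 2 <= #|V2 E|%:R :> R /\
     exists e1 e2 : 'cV[F]_2,
       [/\ e1 \in E, e2 \in E, e1 != e2 &
         exists (m : nat) (x : 'I_m -> 'cV[F]_2),
           [/\ (#|F|%:R - 1) / 2 <= m%:R :> R,
               forall i, x i \in E,
               forall i, det2 (e1 - x i) (e2 - x i) != 0 &
               injective (fun i => det2 (e1 - x i) (e2 - x i))]]) /\
  (exists C : R, forall (F : finFieldType) (E : {set 'cV[F]_2}),
     C <= #|F|%:R ->
     64 * #|F|%:R * log2 #|F|%:R <= #|E|%:R :> R ->
     exists2 z : 'cV[F]_2, z \in E & #|F|%:R / 2 < #|V2_pinned z E|%:R :> R).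
Proof.
split=> [F E FE|].
  have [e1 [e2 [e1E e2E e12 rich]]] := exists_rich_base_areas FE.
  (* Let b be the number of base areas. Since q + n < 2 n, cancelling n in [rich] gives q + 1 < 2 (b
     + 1). *)
  have many : (#|F| <= 2 * #|base_areas e1 e2 E| + 1)%N by nia.
  have manyR : (#|F|%:R - 1) / 2 <= #|base_areas e1 e2 E|%:R :> R.
    by move: many; rewrite -(ler_nat R) natrD natrM; lra.
  split.
    apply: le_trans manyR _.
    by rewrite ler_nat subset_leq_card // base_areas_sub_V2.
  exists e1, e2; split=> //; exists #|base_areas e1 e2 E|.
  by have [x [xE x_neq0 x_inj]] := base_areas_index e1 e2 E; exists x.
(* The threshold 3 comes from the final count: q + n <= 3 n / 2 turns [rich] into 2 (q + 1) <= 3 (b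
   + 1), so 2 b >= (4 q - 2) / 3, which exceeds q once q > 2. *)
exists 3 => F E; rewrite ler_nat => F_ge3 largeE.
have log_ge1 : 1 <= log2 #|F|%:R :> R.
  have ln2_gt0 : 0 < ln 2 :> R by rewrite ln_gt0 ?ltr1n.
  rewrite /log2 ler_pdivlMr // mul1r ler_ln ?posrE ?ltr0n ?ler_nat //; lia.
have E_ge : (2 * #|F| <= #|E|)%N.
  rewrite -(ler_nat R) natrM; apply: le_trans largeE.
  have : 0 <= #|F|%:R :> R by [].
  nra.
have FE : (#|F| < #|E|)%N by lia.
have [e1 [e2 [e1E e2E _ rich]]] := exists_rich_base_areas FE.
exists e1 => //.
have many : (#|F| < 2 * #|base_areas e1 e2 E|)%N by nia.
apply: (@lt_le_trans _ _ #|base_areas e1 e2 E|%:R).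
  by move: many; rewrite -(ltr_nat R) natrM; lra.
by rewrite ler_nat subset_leq_card // base_areas_sub_pinned.
Qed.
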